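(* $I\Sigma_1$ is conservative over $\mathbb T$: for every sequent $\varphi(\bar x)\vdash_{\bar x}\psi(\bar x)$ in the language of $\mathbb T$, if it is provable in $I\Sigma_1$ then it is provable in $\mathbb T$.
   Context: Coherent logic: formulas built from atomic formulas (including equalities) using only $\top,\bot,\wedge,\vee,\exists$; sequents $\varphi\vdash_{\bar x}\psi$ derived with the standard coherent deduction system. PrimRec is the set of primitive recursive function descriptions generated from $\mathsf z$ (constant $0$), $\mathsf s$ (successor), projections $\pi^n_k$, composition $\mathrm{Cn}[\mathsf h,\mathsf g_1,\dots,\mathsf g_n]$ and primitive recursion $\mathrm{Pr}[\mathsf g,\mathsf h]$. The coherent arithmetic $\mathbb T$ has a constant $\mathsf 0$, a function symbol for each element of PrimRec, and a binary predicate $<$, with axioms: $\mathsf zx=\mathsf 0$; $\pi^n_k(x_1,\dots,x_n)=x_k$; $\mathsf sx=\mathsf 0\vdash\bot$; $\mathsf sx=\mathsf sy\vdash x=y$; the defining equations of each composition and primitive recursion symbol; $x<y\dashv\vdash\exists z(x+\mathsf sz=y)$ with $+$ the PrimRec addition. Formulas may also use bounded universal quantifiers $\forall z<t\,\varphi$ ($t$ not containing $z$) with the double rule $\psi\vdash\forall z<t\,\varphi$ iff $\psi\wedge z<t\vdash\varphi$ ($z$ not free in $\psi$), and $\mathbb T$ has the induction rules (IndR): from $\psi(\bar x)\vdash\varphi(\bar x,\mathsf 0)$ and $\psi(\bar x)\wedge\varphi(\bar x,y)\vdash\varphi(\bar x,\mathsf sy)$ infer $\psi(\bar x)\vdash_{\bar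 x,y}\varphi(\bar x,y)$; (IndL): from $\psi(\bar x,\mathsf 0)\vdash\varphi(\bar x)$ and $\psi(\bar x,\mathsf sy)\vdash\varphi(\bar x)\vee\psi(\bar x,y)$ infer $\psi(\bar x,y)\vdash_{\bar x,y}\varphi(\bar x)$. $I\Sigma_1$ is the classical first-order theory of arithmetic with the basic axioms for $0$, successor, addition, multiplication, and the induction schema restricted to $\Sigma_1$-formulas; here it is taken in its definitional extension by all function symbols of PrimRec with their defining axioms and $<$ with its defining axiom, so that every $\mathbb T$-formula is an $I\Sigma_1$-formula (reading $\forall z<t\,\varphi$ as $\forall z(z<t\to\varphi)$), and a sequent $\varphi\vdash_{\bar x}\psi$ is provable in $I\Sigma_1$ when $I\Sigma_1\vdash\forall\bar x(\varphi\to\psi)$. *)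

(* Defs.v *)
From mathcomp Require Import all_boot.

Set Implicit Arguments.
Unset Strict Implicit.
Unset Printing Implicit Defensive.

(* A finite tuple of length k is a function on 'I_k. *)

Definition scons (T : Type) (n : nat) (x : T) (xs : 'I_n -> T) : 'I_n.+1 -> T :=
  fun i => if unlift ord0 i is Some j then xs j else x.

Definition snoc (T : Type) (n : nat) (xs : 'I_n -> T) (x : T) : 'I_n.+1 -> T :=
  fun i => if unlift ord_max i is Some j then xs j else x.

(* The index is the arity.  Since z is unary, primrec 0 is empty, so PrCn with
   n = 0 and PrPr with n = 0 produce nothing. *)
Inductive primrec : nat -> Type :=
| PrZ : primrec 1
| PrS : primrec 1
| PrProj (n : nat) (k : 'I_n) : primrec n
| PrCn (n m : nat) (h : primrec n) (g : 'I_n -> primrec m) : primrec m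
| PrPr (n : nat) (g : primrec n) (h : primrec n.+2) : primrec n.+1.

(* x + 0 = x and x + s y = s (x + y) *)
Definition PrAdd : primrec 2 :=
  PrPr (PrProj (ord0 : 'I_1)) (PrCn PrS (fun _ => PrProj (ord_max : 'I_3))).

(* x * 0 = 0 and x * s y = x * y + x *)
Definition PrMul : primrec 2 :=
  PrPr PrZ (PrCn PrAdd (tnth [tuple PrProj (ord_max : 'I_3);
                                    PrProj (ord0 : 'I_3)])).

(* Well-scoped de Bruijn syntax: the index n of a term or a formula is the
   length of its context of free variables; a quantifier binds variable ord0 of
   the extended context and shifts the others by lift ord0. *)

Inductive tm (n : nat) : Type :=
| Var (i : 'I_n)
| Zero
| App (k : nat) (f : primrec k) (ts : 'I_k -> tm n).

Arguments Zero {n}.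

Fixpoint tsubst (n m : nat) (sigma : 'I_n -> tm m) (t : tm n) : tm m :=
  match t with
  | Var i => sigma i
  | Zero => Zero
  | App k f ts => App f (fun i => tsubst sigma (ts i))
  end.

Definition shift (n : nat) : 'I_n -> tm n.+1 := fun i => Var (lift ord0 i).

Definition up (n m : nat) (sigma : 'I_n -> tm m) : 'I_n.+1 -> tm m.+1 :=
  scons (Var ord0) (fun i => tsubst (@shift m) (sigma i)).

Definition inst (n : nat) (t : tm n) : 'I_n.+1 -> tm n := scons t (@Var n).

Definition Succ (n : nat) (t : tm n) : tm n := App PrS (fun _ => t).
Definition Add (n : nat) (s t : tm n) : tm n := App PrAdd (tnth [tuple s; t]).
Definition Mul (n : nat) (s t : tm n) : tm n := App PrMul (tnth [tuple s; t]).

(* substitutes s y for y = Var ord0 and fixes the other variables *)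
Definition succ_inst (n : nat) : 'I_n.+1 -> tm n.+1 :=
  scons (Succ (Var ord0)) (@shift n).

(* def_eqn s t: the equation s = t, in its context of variables, is one of the
   defining equations of the function symbols. *)
Inductive def_eqn : forall n : nat, tm n -> tm n -> Prop :=
| DefZ : def_eqn (App PrZ (@Var 1)) Zero
| DefProj (n : nat) (k : 'I_n) : def_eqn (App (PrProj k) (@Var n)) (Var k)
| DefCn (n m : nat) (h : primrec n) (g : 'I_n -> primrec m) :
    def_eqn (App (PrCn h g) (@Var m)) (App h (fun i => App (g i) (@Var m)))
| DefPr0 (n : nat) (g : primrec n) (h : primrec n.+2) :
    def_eqn (App (PrPr g h) (snoc (@Var n) Zero)) (App g (@Var n))
| DefPrS (n : nat) (g : primrec n) (h : primrec n.+2) :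
    let xs := @shift n in let y := Var (ord0 : 'I_n.+1) in
    def_eqn (App (PrPr g h) (snoc xs (Succ y)))
            (App h (snoc (snoc xs y) (App (PrPr g h) (snoc xs y)))).

(** Coherent arithmetic *)

(* CBAll t phi is "forall z < t, phi"; t lives in the outer context, hence does
   not contain z. *)
Inductive cform (n : nat) : Type :=
| CEq (s t : tm n)
| CLt (s t : tm n)
| CTop
| CBot
| CAnd (phi psi : cform n)
| COr (phi psi : cform n)
| CEx (phi : cform n.+1)
| CBAll (t : tm n) (phi : cform n.+1).

Arguments CTop {n}.
Arguments CBot {n}.

Fixpoint csubst (n m : nat) (sigma : 'I_n -> tm m) (phi : cform n) : cform m :=
  match phi with
  | CEq s t => CEq (tsubst sigma s) (tsubst sigma t)
  | CLt s t => CLt (tsubst sigma s) (tsubst sigma t)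
  | CTop => CTop
  | CBot => CBot
  | CAnd a b => CAnd (csubst sigma a) (csubst sigma b)
  | COr a b => COr (csubst sigma a) (csubst sigma b)
  | CEx a => CEx (csubst (up sigma) a)
  | CBAll t a => CBAll (tsubst sigma t) (csubst (up sigma) a)
  end.

Definition cshift (n : nat) (phi : cform n) : cform n.+1 := csubst (@shift n) phi.

Inductive T_axiom : forall n : nat, cform n -> cform n -> Prop :=
| T_def (n : nat) (s t : tm n) : def_eqn s t -> T_axiom CTop (CEq s t)
| T_succ_neq0 : T_axiom (CEq (Succ (Var (ord0 : 'I_1))) Zero) CBot
| T_succ_inj :
    let x := Var (ord0 : 'I_2) in let y := Var (ord_max : 'I_2) in
    T_axiom (CEq (Succ x) (Succ y)) (CEq x y)
| T_lt_ex :
    let x := Var (ord0 : 'I_2) in let y := Var (ord_max : 'I_2) in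
    T_axiom (CLt x y)
      (CEx (CEq (Add (tsubst (@shift 2) x) (Succ (Var ord0)))
                (tsubst (@shift 2) y)))
| T_ex_lt :
    let x := Var (ord0 : 'I_2) in let y := Var (ord_max : 'I_2) in
    T_axiom
      (CEx (CEq (Add (tsubst (@shift 2) x) (Succ (Var ord0)))
                (tsubst (@shift 2) y)))
      (CLt x y).

(* T_proves phi psi, for phi psi : cform n, is derivability of the sequent
   phi |- psi in a context of n variables. *)
Inductive T_proves : forall n : nat, cform n -> cform n -> Prop :=
| TP_ax n (phi psi : cform n) : T_axiom phi psi -> T_proves phi psi
| TP_id n (phi : cform n) : T_proves phi phi
| TP_subst n m (sigma : 'I_n -> tm m) (phi psi : cform n) :
    T_proves phi psi -> T_proves (csubst sigma phi) (csubst sigma psi)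
| TP_cut n (phi psi chi : cform n) :
    T_proves phi psi -> T_proves psi chi -> T_proves phi chi
| TP_refl n (t : tm n) : T_proves CTop (CEq t t)
| TP_leibniz n (s t : tm n) (phi : cform n.+1) :
    T_proves (CAnd (CEq s t) (csubst (inst s) phi)) (csubst (inst t) phi)
| TP_top n (phi : cform n) : T_proves phi CTop
| TP_andl n (phi psi : cform n) : T_proves (CAnd phi psi) phi
| TP_andr n (phi psi : cform n) : T_proves (CAnd phi psi) psi
| TP_and n (phi psi chi : cform n) :
    T_proves phi psi -> T_proves phi chi -> T_proves phi (CAnd psi chi)
| TP_bot n (phi : cform n) : T_proves CBot phi
| TP_orl n (phi psi : cform n) : T_proves phi (COr phi psi)
| TP_orr n (phi psi : cform n) : T_proves psi (COr phi psi)
| TP_or n (phi psi chi : cform n) :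
    T_proves phi chi -> T_proves psi chi -> T_proves (COr phi psi) chi
| TP_ex_down n (phi : cform n.+1) (psi : cform n) :
    T_proves phi (cshift psi) -> T_proves (CEx phi) psi
| TP_ex_up n (phi : cform n.+1) (psi : cform n) :
    T_proves (CEx phi) psi -> T_proves phi (cshift psi)
| TP_distr n (phi psi chi : cform n) :
    T_proves (CAnd phi (COr psi chi)) (COr (CAnd phi psi) (CAnd phi chi))
| TP_frobenius n (phi : cform n) (psi : cform n.+1) :
    T_proves (CAnd phi (CEx psi)) (CEx (CAnd (cshift phi) psi))
| TP_ball_down n (t : tm n) (psi : cform n) (phi : cform n.+1) :
    T_proves (CAnd (cshift psi) (CLt (Var ord0) (tsubst (@shift n) t))) phi ->
    T_proves psi (CBAll t phi)
| TP_ball_up n (t : tm n) (psi : cform n) (phi : cform n.+1) :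
    T_proves psi (CBAll t phi) ->
    T_proves (CAnd (cshift psi) (CLt (Var ord0) (tsubst (@shift n) t))) phi
| TP_indR n (psi : cform n) (phi : cform n.+1) :
    T_proves psi (csubst (inst Zero) phi) ->
    T_proves (CAnd (cshift psi) phi) (csubst (@succ_inst n) phi) ->
    T_proves (cshift psi) phi
| TP_indL n (phi : cform n) (psi : cform n.+1) :
    T_proves (csubst (inst Zero) psi) phi ->
    T_proves (csubst (@succ_inst n) psi) (COr (cshift phi) psi) ->
    T_proves psi (cshift phi).

(** Classical first-order logic and ISigma1 *)

Inductive fform (n : nat) : Type :=
| FEq (s t : tm n)
| FLt (s t : tm n)
| FTop
| FBot
| FAnd (phi psi : fform n)
| FOr (phi psi : fform n)
| FImp (phi psi : fform n)
| FEx (phi : fform n.+1)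
| FAll (phi : fform n.+1).

Arguments FTop {n}.
Arguments FBot {n}.

Fixpoint fsubst (n m : nat) (sigma : 'I_n -> tm m) (phi : fform n) : fform m :=
  match phi with
  | FEq s t => FEq (tsubst sigma s) (tsubst sigma t)
  | FLt s t => FLt (tsubst sigma s) (tsubst sigma t)
  | FTop => FTop
  | FBot => FBot
  | FAnd a b => FAnd (fsubst sigma a) (fsubst sigma b)
  | FOr a b => FOr (fsubst sigma a) (fsubst sigma b)
  | FImp a b => FImp (fsubst sigma a) (fsubst sigma b)
  | FEx a => FEx (fsubst (up sigma) a)
  | FAll a => FAll (fsubst (up sigma) a)
  end.

Definition fshift (n : nat) (phi : fform n) : fform n.+1 := fsubst (@shift n) phi.

Definition FNot (n : nat) (phi : fform n) : fform n := FImp phi FBot.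
Definition FIff (n : nat) (phi psi : fform n) : fform n :=
  FAnd (FImp phi psi) (FImp psi phi).

Definition FBAll (n : nat) (t : tm n) (phi : fform n.+1) : fform n :=
  FAll (FImp (FLt (Var ord0) (tsubst (@shift n) t)) phi).
Definition FBEx (n : nat) (t : tm n) (phi : fform n.+1) : fform n :=
  FEx (FAnd (FLt (Var ord0) (tsubst (@shift n) t)) phi).

Fixpoint univ_closure (n : nat) : fform n -> fform 0 :=
  match n with
  | 0 => fun phi => phi
  | n'.+1 => fun phi => univ_closure (FAll phi)
  end.

Fixpoint embed (n : nat) (phi : cform n) : fform n :=
  match phi with
  | CEq s t => FEq s t
  | CLt s t => FLt s t
  | CTop => FTop
  | CBot => FBot
  | CAnd a b => FAnd (embed a) (embed b)
  | COr a b => FOr (embed a) (embed b)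
  | CEx a => FEx (embed a)
  | CBAll t a => FBAll t (embed a)
  end.

(* Classical natural deduction with equality from a set Ax of sentences;
   Gamma is the list of open assumptions. *)
Inductive fol_proves (Ax : fform 0 -> Prop) :
    forall n : nat, seq (fform n) -> fform n -> Prop :=
| FP_ax n (Gamma : seq (fform n)) (phi : fform 0) :
    Ax phi ->
    fol_proves Ax Gamma (fsubst (fun i => Var (widen_ord (leq0n n) i)) phi)
| FP_hyp n (Gamma1 Gamma2 : seq (fform n)) phi :
    fol_proves Ax (Gamma1 ++ phi :: Gamma2) phi
| FP_topI n (Gamma : seq (fform n)) : fol_proves Ax Gamma FTop
| FP_raa n (Gamma : seq (fform n)) phi :
    fol_proves Ax (FNot phi :: Gamma) FBot -> fol_proves Ax Gamma phi
| FP_andI n (Gamma : seq (fform n)) phi psi :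
    fol_proves Ax Gamma phi -> fol_proves Ax Gamma psi ->
    fol_proves Ax Gamma (FAnd phi psi)
| FP_andEl n (Gamma : seq (fform n)) phi psi :
    fol_proves Ax Gamma (FAnd phi psi) -> fol_proves Ax Gamma phi
| FP_andEr n (Gamma : seq (fform n)) phi psi :
    fol_proves Ax Gamma (FAnd phi psi) -> fol_proves Ax Gamma psi
| FP_orIl n (Gamma : seq (fform n)) phi psi :
    fol_proves Ax Gamma phi -> fol_proves Ax Gamma (FOr phi psi)
| FP_orIr n (Gamma : seq (fform n)) phi psi :
    fol_proves Ax Gamma psi -> fol_proves Ax Gamma (FOr phi psi)
| FP_orE n (Gamma : seq (fform n)) phi psi chi :
    fol_proves Ax Gamma (FOr phi psi) ->
    fol_proves Ax (phi :: Gamma) chi -> fol_proves Ax (psi :: Gamma) chi ->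
    fol_proves Ax Gamma chi
| FP_impI n (Gamma : seq (fform n)) phi psi :
    fol_proves Ax (phi :: Gamma) psi -> fol_proves Ax Gamma (FImp phi psi)
| FP_impE n (Gamma : seq (fform n)) phi psi :
    fol_proves Ax Gamma (FImp phi psi) -> fol_proves Ax Gamma phi ->
    fol_proves Ax Gamma psi
| FP_allI n (Gamma : seq (fform n)) (phi : fform n.+1) :
    fol_proves Ax (map (@fshift n) Gamma) phi -> fol_proves Ax Gamma (FAll phi)
| FP_allE n (Gamma : seq (fform n)) (phi : fform n.+1) (t : tm n) :
    fol_proves Ax Gamma (FAll phi) -> fol_proves Ax Gamma (fsubst (inst t) phi)
| FP_exI n (Gamma : seq (fform n)) (phi : fform n.+1) (t : tm n) :
    fol_proves Ax Gamma (fsubst (inst t) phi) -> fol_proves Ax Gamma (FEx phi)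
| FP_exE n (Gamma : seq (fform n)) (phi : fform n.+1) (psi : fform n) :
    fol_proves Ax Gamma (FEx phi) ->
    fol_proves Ax (phi :: map (@fshift n) Gamma) (fshift psi) ->
    fol_proves Ax Gamma psi
| FP_eqI n (Gamma : seq (fform n)) (t : tm n) : fol_proves Ax Gamma (FEq t t)
| FP_eqE n (Gamma : seq (fform n)) (s t : tm n) (phi : fform n.+1) :
    fol_proves Ax Gamma (FEq s t) -> fol_proves Ax Gamma (fsubst (inst s) phi) ->
    fol_proves Ax Gamma (fsubst (inst t) phi).

Inductive delta0 : forall n : nat, fform n -> Prop :=
| D0_eq n (s t : tm n) : delta0 (FEq s t)
| D0_lt n (s t : tm n) : delta0 (FLt s t)
| D0_top n : delta0 (@FTop n)
| D0_bot n : delta0 (@FBot n)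
| D0_and n (phi psi : fform n) : delta0 phi -> delta0 psi -> delta0 (FAnd phi psi)
| D0_or n (phi psi : fform n) : delta0 phi -> delta0 psi -> delta0 (FOr phi psi)
| D0_imp n (phi psi : fform n) : delta0 phi -> delta0 psi -> delta0 (FImp phi psi)
| D0_ball n (t : tm n) (phi : fform n.+1) : delta0 phi -> delta0 (FBAll t phi)
| D0_bex n (t : tm n) (phi : fform n.+1) : delta0 phi -> delta0 (FBEx t phi).

Inductive sigma1 : forall n : nat, fform n -> Prop :=
| S1_delta0 n (phi : fform n) : delta0 phi -> sigma1 phi
| S1_ex n (phi : fform n.+1) : sigma1 phi -> sigma1 (FEx phi).

(* ISigma1 over the expanded language.  The induction schema ranges over the
   Sigma1 formulas of the expanded language: in the definitional extension
   these are provably equivalent to Sigma1 formulas in 0, s, +, *, whereas the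
   recursion equations without induction for formulas containing the new
   symbols would not determine these symbols. *)
Inductive ISigma1 : fform 0 -> Prop :=
| IS_succ_neq0 :
    ISigma1 (univ_closure (FNot (FEq (Succ (Var (ord0 : 'I_1))) Zero)))
| IS_succ_inj :
    let x := Var (ord0 : 'I_2) in let y := Var (ord_max : 'I_2) in
    ISigma1 (univ_closure (FImp (FEq (Succ x) (Succ y)) (FEq x y)))
| IS_add0 :
    let x := Var (ord0 : 'I_1) in
    ISigma1 (univ_closure (FEq (Add x Zero) x))
| IS_addS :
    let x := Var (ord0 : 'I_2) in let y := Var (ord_max : 'I_2) in
    ISigma1 (univ_closure (FEq (Add x (Succ y)) (Succ (Add x y))))
| IS_mul0 :
    let x := Var (ord0 : 'I_1) in
    ISigma1 (univ_closure (FEq (Mul x Zero) Zero))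
| IS_mulS :
    let x := Var (ord0 : 'I_2) in let y := Var (ord_max : 'I_2) in
    ISigma1 (univ_closure (FEq (Mul x (Succ y)) (Add (Mul x y) x)))
| IS_def n (s t : tm n) : def_eqn s t -> ISigma1 (univ_closure (FEq s t))
| IS_lt :
    let x := Var (ord0 : 'I_2) in let y := Var (ord_max : 'I_2) in
    ISigma1 (univ_closure (FIff (FLt x y)
      (FEx (FEq (Add (tsubst (@shift 2) x) (Succ (Var ord0)))
                (tsubst (@shift 2) y)))))
| IS_ind n (phi : fform n.+1) :
    sigma1 phi ->
    ISigma1 (univ_closure
      (FImp (FAnd (fsubst (inst Zero) phi)
                  (FAll (FImp phi (fsubst (@succ_inst n) phi))))
            (FAll phi))).

Definition ISigma1_proves (n : nat) (phi psi : cform n) : Prop :=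
  fol_proves ISigma1 [::] (univ_closure (FImp (embed phi) (embed psi))).

(* Main.v *)
(** A forcing (negative translation) argument.  A condition is a pair (G, D) of
    coherent formulas, and it forces an atom A when T proves [G |- A \/ D];
    conditions are extended by substituting terms, strengthening G and weakening
    D.  Implication and universal quantification are interpreted as in Kripke
    models, disjunction and existence through double negation, so that classical
    logic is sound.  Every coherent formula A, like an atom, is forced exactly
    when [G |- A \/ D]; for bounded universal quantifiers this needs
    [forall z < t, A \/ D |- (forall z < t, A) \/ D], which is proved in T by
    induction.  As T decides atoms, every Sigma1 formula is forced like some
    coherent one, and then IndR with the induction formula [A \/ D] shows that
    the Sigma1 induction axioms are forced.  Forcing a sequent's implication at
    the condition (phi, bot) yields the derivation of [phi |- psi]. *)

From mathcomp Require Import all_boot.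
From Stdlib Require Import FunctionalExtensionality PropExtensionality.
From Stdlib Require List.
Require Import Defs.

Set Implicit Arguments.
Unset Strict Implicit.
Unset Printing Implicit Defensive.

Local Notation "phi |-- psi" := (T_proves phi psi) (at level 70, psi at next level).

(** * Substitution calculus *)

Definition comp k n m (s : 'I_k -> tm n) (r : 'I_n -> tm m) : 'I_k -> tm m :=
  fun i => tsubst r (s i).

Lemma scons0 T n (x : T) (xs : 'I_n -> T) : scons x xs ord0 = x.
Proof. by rewrite /scons unlift_none. Qed.

Lemma scons_lift T n (x : T) (xs : 'I_n -> T) i : scons x xs (lift ord0 i) = xs i.
Proof. by rewrite /scons liftK. Qed.

Lemma scons_ext T n (f g : 'I_n.+1 -> T) :
  f ord0 = g ord0 -> (forall i, f (lift ord0 i) = g (lift ord0 i)) -> f = g.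
Proof.
move=> h0 hl; apply: functional_extensionality => i.
by case: (unliftP ord0 i) => [j|] ->.
Qed.

Lemma tsubst_comp k n m (s : 'I_k -> tm n) (r : 'I_n -> tm m) t :
  tsubst r (tsubst s t) = tsubst (comp s r) t.
Proof.
elim: t => //= j f ts IH; congr App.
by apply: functional_extensionality => i; apply: IH.
Qed.

Lemma tsubst_var n (t : tm n) : tsubst (@Var n) t = t.
Proof.
elim: t => //= j f ts IH; congr App.
by apply: functional_extensionality => i; apply: IH.
Qed.

Lemma comp_assoc k n m l (s : 'I_k -> tm n) (r : 'I_n -> tm m) (u : 'I_m -> tm l) :
  comp (comp s r) u = comp s (comp r u).
Proof. by apply: functional_extensionality => i; rewrite /comp tsubst_comp. Qed.

Lemma comp_var_l n m (s : 'I_n -> tm m) : comp (@Var n) s = s.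
Proof. by apply: functional_extensionality. Qed.

Lemma comp_var_r n m (s : 'I_n -> tm m) : comp s (@Var m) = s.
Proof. by apply: functional_extensionality => i; apply: tsubst_var. Qed.

Lemma comp_scons k n m t (s : 'I_k -> tm n) (r : 'I_n -> tm m) :
  comp (scons t s) r = scons (tsubst r t) (comp s r).
Proof. by apply: scons_ext => [|i]; rewrite /comp ?scons0 ?scons_lift. Qed.

Lemma comp_shift n m t (s : 'I_n -> tm m) : comp (@shift n) (scons t s) = s.
Proof. by apply: functional_extensionality => i; rewrite /comp /= scons_lift. Qed.

Lemma scons_var n : scons (Var ord0) (@shift n) = @Var n.+1.
Proof. by apply: scons_ext => [|i]; rewrite ?scons0 ?scons_lift. Qed.

Lemma scons_eta n m (s : 'I_n.+1 -> tm m) : scons (s ord0) (comp (@shift n) s) = s.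
Proof. by apply: scons_ext => [|i]; rewrite ?scons0 ?scons_lift. Qed.

Lemma upE n m (s : 'I_n -> tm m) : up s = scons (Var ord0) (comp s (@shift m)).
Proof. by []. Qed.

Lemma tsubst_Var n m (s : 'I_n -> tm m) i : tsubst s (Var i) = s i.
Proof. by []. Qed.

Lemma tsubst_Zero n m (s : 'I_n -> tm m) : tsubst s Zero = Zero.
Proof. by []. Qed.

Lemma tsubst_Succ n m (s : 'I_n -> tm m) t : tsubst s (Succ t) = Succ (tsubst s t).
Proof. by []. Qed.

Lemma comp_tuple2 n m (s : 'I_n -> tm m) a b :
  comp (tnth [tuple a; b]) s = tnth [tuple tsubst s a; tsubst s b].
Proof. by apply: functional_extensionality => -[[|[|i]] //= hi]. Qed.

Lemma tsubst_Add n m (s : 'I_n -> tm m) a b :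
  tsubst s (Add a b) = Add (tsubst s a) (tsubst s b).
Proof. by rewrite /Add -comp_tuple2. Qed.

Lemma tsubst_Mul n m (s : 'I_n -> tm m) a b :
  tsubst s (Mul a b) = Mul (tsubst s a) (tsubst s b).
Proof. by rewrite /Mul -comp_tuple2. Qed.

Lemma csubst_comp k n m (s : 'I_k -> tm n) (r : 'I_n -> tm m) A :
  csubst r (csubst s A) = csubst (comp s r) A.
Proof.
elim: A n m s r => /= {k}.
- by move=> k a b n m s r; rewrite !tsubst_comp.
- by move=> k a b n m s r; rewrite !tsubst_comp.
- by [].
- by [].
- by move=> k A IA B IB n m s r; rewrite IA IB.
- by move=> k A IA B IB n m s r; rewrite IA IB.
- move=> k A IA n m s r; rewrite IA !upE comp_scons /= scons0.
  by rewrite !comp_assoc comp_shift.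
- move=> k t A IA n m s r; rewrite IA !upE comp_scons /= scons0 tsubst_comp.
  by rewrite !comp_assoc comp_shift.
Qed.

Lemma csubst_var n (A : cform n) : csubst (@Var n) A = A.
Proof.
have upv k : up (@Var k) = @Var k.+1 by rewrite upE comp_var_l scons_var.
elim: A => //= {n}.
- by move=> n a b; rewrite !tsubst_var.
- by move=> n a b; rewrite !tsubst_var.
- by move=> n A -> B ->.
- by move=> n A -> B ->.
- by move=> n A IA; rewrite upv IA.
- by move=> n t A IA; rewrite upv IA tsubst_var.
Qed.

(** Oriented equations of the substitution calculus: compositions nest to the right and cancel
    against [scons], so that two ways of computing one instance meet in a common form. *)
Definition substE := (csubst_comp, tsubst_comp, comp_scons, comp_assoc, comp_shift,
  comp_var_l, comp_var_r, csubst_var, tsubst_var, scons0, scons_lift, scons_var,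
  tsubst_Var, tsubst_Zero, tsubst_Succ, tsubst_Add, tsubst_Mul).

Ltac ssimpl := rewrite /cshift /succ_inst /inst; cbn [csubst]; rewrite ?upE ?substE.

(** * Derived rules of coherent logic *)

Section Rules.
Variable n : nat.
Implicit Types (G D A B C : cform n) (s t u : tm n).

Lemma weaken G A B : G |-- A -> CAnd G B |-- A.
Proof. by apply: TP_cut; apply: TP_andl. Qed.

Lemma bot_elim G A : G |-- CBot -> G |-- A.
Proof. by move/TP_cut; apply; apply: TP_bot. Qed.

Lemma or_intro_l G A B : G |-- A -> G |-- COr A B.
Proof. by move/TP_cut; apply; apply: TP_orl. Qed.

Lemma or_intro_r G A B : G |-- B -> G |-- COr A B.
Proof. by move/TP_cut; apply; apply: TP_orr. Qed.

(** Without implication the context G cannot be moved to the right of a sequent; distributivity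
    carries it into both branches. In [ex_elim] the Frobenius axiom plays the same role. *)
Lemma or_elim G A B C :
  G |-- COr A B -> CAnd G A |-- C -> CAnd G B |-- C -> G |-- C.
Proof.
move=> h hA hB; apply: (TP_cut (psi := CAnd G (COr A B))).
  by apply: TP_and => //; apply: TP_id.
by apply: TP_cut (TP_distr _ _ _) _; apply: TP_or.
Qed.

Lemma cut_ctx G A B : G |-- A -> CAnd G A |-- B -> G |-- B.
Proof. by move=> h; apply: TP_cut; apply: TP_and => //; apply: TP_id. Qed.

Lemma or_mono_l A B D : A |-- B -> COr A D |-- COr B D.
Proof.
by move=> h; apply: TP_or; [apply: or_intro_l|apply: or_intro_r; apply: TP_id].
Qed.

Lemma or_mono_r A B D : A |-- B -> COr D A |-- COr D B.
Proof.
by move=> h; apply: TP_or; [apply: or_intro_l; apply: TP_id|apply: or_intro_r].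
Qed.

Lemma or_bot_l A : COr CBot A |-- A.
Proof. by apply: TP_or; [apply: TP_bot|apply: TP_id]. Qed.

(** Reasoning under a fixed side disjunct D, as in a monad. Forced atoms have the form [COr A D], so
    their consequences are drawn this way. *)
Lemma or_bind G A B D :
  G |-- COr A D -> CAnd G A |-- COr B D -> G |-- COr B D.
Proof. by move=> h h1; apply: or_elim h h1 _; apply: or_intro_r; apply: TP_andr. Qed.

Lemma ex_elim G (A : cform n.+1) C :
  G |-- CEx A -> CAnd (cshift G) A |-- cshift C -> G |-- C.
Proof.
move=> h hA; apply: cut_ctx h _; apply: TP_cut (TP_frobenius _ _) _.
exact: TP_ex_down.
Qed.

(** The two-way rule only yields [A |-- cshift (CEx A)] for the generic variable; substituting t
    into it gives the usual introduction rule. *)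
Lemma cex_intro G (A : cform n.+1) t : G |-- csubst (inst t) A -> G |-- CEx A.
Proof.
move/TP_cut; apply; have := TP_subst (inst t) (TP_ex_up (TP_id (CEx A))).
by ssimpl.
Qed.

Lemma ball_elim G t (A : cform n.+1) u :
  G |-- CBAll t A -> G |-- CLt u t -> G |-- csubst (inst u) A.
Proof.
move=> h1 h2; have := TP_subst (inst u) (TP_ball_up (TP_id (CBAll t A))).
by ssimpl => h; apply: TP_cut h; apply: TP_and.
Qed.

Lemma ind_elim G (A : cform n.+1) t : G |-- csubst (inst Zero) A ->
  CAnd (cshift G) A |-- csubst (@succ_inst n) A -> G |-- csubst (inst t) A.
Proof. by move=> h0 hS; have := TP_subst (inst t) (TP_indR h0 hS); ssimpl. Qed.

Lemma ceq_refl G t : G |-- CEq t t.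
Proof. by apply: TP_cut (TP_refl t); apply: TP_top. Qed.

Lemma eq_rew G s t (A : cform n.+1) :
  G |-- CEq s t -> G |-- csubst (inst s) A -> G |-- csubst (inst t) A.
Proof. by move=> h1 h2; apply: TP_cut (TP_leibniz s t A); apply: TP_and. Qed.

Lemma ceq_sym G s t : G |-- CEq s t -> G |-- CEq t s.
Proof.
move=> h; have := eq_rew (A := CEq (Var ord0) (tsubst (@shift n) s)) h.
by ssimpl; apply; apply: ceq_refl.
Qed.

Lemma ceq_trans G s t u : G |-- CEq s t -> G |-- CEq t u -> G |-- CEq s u.
Proof.
move=> h1 h2; have := eq_rew (A := CEq (tsubst (@shift n) s) (Var ord0)) h2.
by ssimpl; apply.
Qed.

Lemma eq_Succ G s t : G |-- CEq s t -> G |-- CEq (Succ s) (Succ t).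
Proof.
move=> h.
have := eq_rew (A := CEq (Succ (tsubst (@shift n) s)) (Succ (Var ord0))) h.
by ssimpl; apply; apply: ceq_refl.
Qed.

Lemma eq_Add G s s' t t' :
  G |-- CEq s s' -> G |-- CEq t t' -> G |-- CEq (Add s t) (Add s' t').
Proof.
move=> h1 h2; pose w := tsubst (@shift n); apply: (ceq_trans (t := Add s' t)).
  have := eq_rew (A := CEq (w (Add s t)) (Add (Var ord0) (w t))) h1.
  by rewrite /w; ssimpl; apply; apply: ceq_refl.
have := eq_rew (A := CEq (w (Add s' t)) (Add (w s') (Var ord0))) h2.
by rewrite /w; ssimpl; apply; apply: ceq_refl.
Qed.

Lemma eq_lt_r G s t u : G |-- CEq t u -> G |-- CLt s t -> G |-- CLt s u.
Proof.
move=> h1 h2; have := eq_rew (A := CLt (tsubst (@shift n) s) (Var ord0)) h1.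
by ssimpl; apply.
Qed.

Lemma eq_lt_l G s t u : G |-- CEq s t -> G |-- CLt s u -> G |-- CLt t u.
Proof.
move=> h1 h2; have := eq_rew (A := CLt (Var ord0) (tsubst (@shift n) u)) h1.
by ssimpl; apply.
Qed.

End Rules.

(** * Arithmetic in T *)

Lemma def_eqn_inst k n (r : 'I_k -> tm n) s t (G : cform n) :
  def_eqn s t -> G |-- CEq (tsubst r s) (tsubst r t).
Proof.
move=> h; apply: TP_cut (TP_top G) _.
exact (TP_subst r (TP_ax (T_def h))).
Qed.

Lemma proj_eq k n (i : 'I_k) (r : 'I_k -> tm n) (G : cform n) :
  G |-- CEq (App (PrProj i) r) (r i).
Proof. exact (def_eqn_inst r G (DefProj i)). Qed.

(** The recursion equations list arguments by [snoc], whereas [Add] and [Mul] pack them in a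
    tuple. *)
Lemma snoc2 n (r : 'I_1 -> tm n) b : snoc r b = tnth [tuple r ord0; b].
Proof.
apply: functional_extensionality => -[[|[|i]] // hi]; rewrite /snoc.
  by case: unliftP => [[[|j] hj] // e|/(congr1 val)] //=; congr r; apply: val_inj.
case: unliftP => [[[|j] hj] // /(congr1 val)|_] //=.
Qed.

Section Arith.
Variable n : nat.
Implicit Types (G : cform n) (a b c x y : tm n).

Lemma comp_snoc k m (s : 'I_k -> tm m) (t : tm m) (r : 'I_m -> tm n) :
  (fun i => tsubst r (snoc s t i)) = snoc (comp s r) (tsubst r t).
Proof.
by apply: functional_extensionality => i; rewrite /snoc; case: unlift.
Qed.

Lemma snoc_max k (s : 'I_k -> tm n) t : snoc s t ord_max = t.
Proof. by rewrite /snoc unlift_none. Qed.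

Lemma snoc_lift k (s : 'I_k -> tm n) t i : snoc s t (lift ord_max i) = s i.
Proof. by rewrite /snoc liftK. Qed.

Lemma add0 G a : G |-- CEq (Add a Zero) a.
Proof.
pose r (_ : 'I_1) := a.
have := def_eqn_inst r G (DefPr0 (PrProj (ord0 : 'I_1))
  (PrCn PrS (fun _ => PrProj (ord_max : 'I_3)))).
rewrite /= comp_snoc snoc2 => h; apply: ceq_trans h _.
exact: proj_eq.
Qed.

Lemma addS G a b : G |-- CEq (Add a (Succ b)) (Succ (Add a b)).
Proof.
(* In [DefPrS] the recursion variable y is [ord0], although it is the last argument of the function;
   hence b comes first. *)
pose r : 'I_2 -> tm n := scons b (fun _ => a).
have := def_eqn_inst r G (DefPrS (PrProj (ord0 : 'I_1))
  (PrCn PrS (fun _ => PrProj (ord_max : 'I_3)))).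
rewrite /= !comp_snoc /= !comp_snoc /= /r scons0 comp_shift !snoc2 => h.
apply: ceq_trans h _.
apply: ceq_trans (def_eqn_inst _ G (DefCn PrS (fun _ => PrProj ord_max))) _.
apply: eq_Succ; apply: ceq_trans (proj_eq _ _ _) _.
by rewrite unlift_none; apply: ceq_refl.
Qed.

Lemma mul0 G a : G |-- CEq (Mul a Zero) Zero.
Proof.
pose r (_ : 'I_1) := a.
have := def_eqn_inst r G (DefPr0 PrZ (PrCn PrAdd (tnth [tuple PrProj (ord_max : 'I_3);
                                    PrProj (ord0 : 'I_3)]))).
rewrite /= comp_snoc snoc2 => h; apply: ceq_trans h _.
exact (def_eqn_inst r G DefZ).
Qed.

Lemma mulS G a b : G |-- CEq (Mul a (Succ b)) (Add (Mul a b) a).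
Proof.
pose r : 'I_2 -> tm n := scons b (fun _ => a).
have := def_eqn_inst r G (DefPrS PrZ (PrCn PrAdd (tnth [tuple PrProj (ord_max : 'I_3);
                                    PrProj (ord0 : 'I_3)]))).
rewrite /= !comp_snoc /= !comp_snoc /= /r scons0 comp_shift !snoc2 => h.
apply: ceq_trans h _.
(* The step function receives the arguments a, b, a * b; its projections [ord_max] and [ord0] select
   a * b and a. *)
set v := snoc _ _.
apply: ceq_trans (def_eqn_inst v G (DefCn PrAdd _)) _ => /=.
have -> : (fun i => App (tnth [tuple PrProj (ord_max : 'I_3); PrProj (ord0 : 'I_3)] i)
    (fun j => v j)) = tnth [tuple App (PrProj (ord_max : 'I_3)) v;
                                  App (PrProj (ord0 : 'I_3)) v].
  by apply: functional_extensionality => -[[|[|i]] //= hi].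
apply: eq_Add; apply: ceq_trans (proj_eq _ _ _) _; rewrite /v.
  by rewrite snoc_max; apply: ceq_refl.
have -> : (ord0 : 'I_3) = lift ord_max (ord0 : 'I_2) by apply: val_inj.
rewrite snoc_lift /comp (tnth_nth Zero) /= scons_lift; exact: ceq_refl.
Qed.

Lemma succ_neq0 G a : G |-- CEq (Succ a) Zero -> G |-- CBot.
Proof.
move=> h; apply: TP_cut h _.
exact (TP_subst (fun _ => a) (TP_ax T_succ_neq0)).
Qed.

Lemma succ_inj G a b : G |-- CEq (Succ a) (Succ b) -> G |-- CEq a b.
Proof.
move=> h; apply: TP_cut h _.
have := TP_subst (tnth [tuple a; b]) (TP_ax T_succ_inj).
by cbn [csubst]; rewrite !substE.
Qed.

Lemma ord_max2 : (ord_max : 'I_2) = lift ord0 (ord0 : 'I_1).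
Proof. exact: val_inj. Qed.

Lemma lt_elim G a b C : G |-- CLt a b ->
  CAnd (cshift G) (CEq (Add (tsubst (@shift n) a) (Succ (Var ord0)))
                       (tsubst (@shift n) b)) |-- cshift C ->
  G |-- C.
Proof.
move=> h; apply: ex_elim; apply: TP_cut h _.
have := TP_subst (scons a (fun _ => b)) (TP_ax T_lt_ex).
by rewrite ord_max2; ssimpl.
Qed.

Lemma lt_intro G a b c : G |-- CEq (Add a (Succ c)) b -> G |-- CLt a b.
Proof.
move=> h; have := TP_subst (scons a (fun _ => b)) (TP_ax T_ex_lt).
rewrite ord_max2; ssimpl; apply: TP_cut; apply: (cex_intro (t := c)).
by ssimpl.
Qed.

End Arith.

Lemma cshift_proves n (G : cform n) C : G |-- C -> cshift G |-- cshift C.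
Proof. exact: TP_subst. Qed.

(** IndR proves that every number is zero or a successor; in the successor step the induction
    variable itself is the predecessor. *)
Lemma nat_case n (G : cform n) a C : CAnd G (CEq a Zero) |-- C ->
  CAnd (cshift G) (CEq (tsubst (@shift n) a) (Succ (Var ord0))) |-- cshift C ->
  G |-- C.
Proof.
move=> h0 hS; apply: (or_elim _ h0
  (B := CEx (CEq (tsubst (@shift n) a) (Succ (Var ord0))))).
  have := @ind_elim _ G (COr (CEq (Var ord0) Zero)
    (CEx (CEq (Var (lift ord0 ord0)) (Succ (Var ord0))))) a.
  ssimpl; apply.
    by apply: or_intro_l; apply: ceq_refl.
  apply: or_intro_r; apply: (cex_intro (t := Var ord0)); ssimpl; exact: ceq_refl.
apply: ex_elim (TP_andr _ _) _; apply: TP_cut hS; apply: TP_and; last exact: TP_andr.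
by apply: weaken; ssimpl; apply: TP_andl.
Qed.

(** * Laws of addition and of the strict order *)

Lemma add_0l n (G : cform n) a : G |-- CEq (Add Zero a) a.
Proof.
have := @ind_elim _ G (CEq (Add Zero (Var ord0)) (Var ord0)) a.
ssimpl; apply; first exact: add0.
by apply: ceq_trans (addS _ _ _) _; apply: eq_Succ; apply: TP_andr.
Qed.

Lemma add_Sl n (G : cform n) a b : G |-- CEq (Add (Succ a) b) (Succ (Add a b)).
Proof.
pose w := tsubst (@shift n).
have := @ind_elim _ G (CEq (Add (Succ (w a)) (Var ord0)) (Succ (Add (w a) (Var ord0)))) b.
rewrite /w; ssimpl; apply.
  by apply: ceq_trans (add0 _ _) _; apply: eq_Succ; apply: ceq_sym; apply: add0.
apply: ceq_trans (addS _ _ _) _; apply: eq_Succ.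
apply: ceq_trans (TP_andr _ _) _; apply: ceq_sym; exact: addS.
Qed.

Lemma addA n (G : cform n) a b c : G |-- CEq (Add a (Add b c)) (Add (Add a b) c).
Proof.
pose w := tsubst (@shift n).
have := @ind_elim _ G (CEq (Add (w a) (Add (w b) (Var ord0)))
  (Add (Add (w a) (w b)) (Var ord0))) c.
rewrite /w; ssimpl; apply.
  apply: ceq_trans (ceq_sym (add0 _ _)).
  by apply: eq_Add; [apply: ceq_refl|apply: add0].
apply: ceq_trans (ceq_sym (addS _ _ _)).
apply: ceq_trans (eq_Add (ceq_refl _ _) (addS _ _ _)) _.
by apply: ceq_trans (addS _ _ _) _; apply: eq_Succ; apply: TP_andr.
Qed.

(** Descent on a by IndL with conclusion bot: the equation for s a reduces to the one for a, and at
    0 it makes a successor equal to 0. Irreflexivity of the order rests on this. *)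
Lemma add_succ_neq n (G : cform n) a c : G |-- CEq (Add a (Succ c)) a -> G |-- CBot.
Proof.
move=> h; apply: TP_cut h _.
pose P := CEq (Add (Var ord0) (Succ (tsubst (@shift n) c))) (Var ord0).
have: P |-- cshift CBot.
  apply: TP_indL; rewrite /P; ssimpl.
    by apply: succ_neq0; apply: ceq_trans (ceq_sym (addS _ _ _)) (TP_id _).
  apply: or_intro_r; apply: succ_inj; apply: ceq_trans (TP_id _).
  by apply: ceq_sym; apply: add_Sl.
by move/(TP_subst (inst a)); rewrite /P; ssimpl.
Qed.

Lemma lt_irrefl n (G : cform n) a : G |-- CLt a a -> G |-- CBot.
Proof. by move/lt_elim; apply; apply: add_succ_neq (TP_andr _ _). Qed.

Lemma lt_trans n (G : cform n) a b c : G |-- CLt a b -> G |-- CLt b c -> G |-- CLt a c.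
Proof.
move=> hab hbc; apply: lt_elim hab _.
have h : CAnd (cshift G) (CEq (Add (tsubst (@shift n) a) (Succ (Var ord0)))
                       (tsubst (@shift n) b)) |-- cshift (CLt b c).
  by apply: weaken; apply: cshift_proves.
apply: lt_elim h _.
apply: (@lt_intro _ _ _ _ (Add (Succ (Var (lift ord0 ord0))) (Var ord0))); ssimpl.
apply: ceq_trans (TP_andr _ _).
apply: (ceq_trans (eq_Add (ceq_refl _ _) (ceq_sym (addS _ _ _)))).
apply: (ceq_trans (addA _ _ _ _)).
by apply: eq_Add (ceq_refl _ _); apply: weaken; apply: TP_andr.
Qed.

Lemma lt_asym n (G : cform n) a b : G |-- CLt a b -> G |-- CLt b a -> G |-- CBot.
Proof. by move=> h1 h2; apply: lt_irrefl (lt_trans h1 h2). Qed.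

Lemma lt_succ n (G : cform n) a : G |-- CLt a (Succ a).
Proof.
apply: (@lt_intro _ _ _ _ Zero).
by apply: ceq_trans (addS _ _ _) _; apply: eq_Succ; apply: add0.
Qed.

Lemma lt0_false n (G : cform n) a : G |-- CLt a Zero -> G |-- CBot.
Proof.
move/lt_elim; apply; apply: (@succ_neq0 _ _ (Add (tsubst (@shift n) a) (Var ord0))).
by apply: ceq_trans (ceq_sym (addS _ _ _)) _; apply: TP_andr.
Qed.

(** A witness z of a < s b satisfies a + z = b; the cases z = 0 and z a successor give the two
    disjuncts. [succ_le] splits on its witness likewise. *)
Lemma lt_succ_inv n (G : cform n) a b :
  G |-- CLt a (Succ b) -> G |-- COr (CLt a b) (CEq a b).
Proof.
move/lt_elim; apply; ssimpl.
set H := CAnd _ _.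
have hz : H |-- CEq (Add (tsubst (@shift n) a) (Var ord0)) (tsubst (@shift n) b).
  by apply: succ_inj; apply: ceq_trans (TP_andr _ _); apply: ceq_sym; apply: addS.
apply: (@nat_case _ H (Var ord0)).
  apply: or_intro_r; apply: ceq_trans (weaken _ hz).
  apply: ceq_trans (ceq_sym (add0 _ _)) _; apply: eq_Add (ceq_refl _ _) _.
  by apply: ceq_sym; apply: TP_andr.
apply: or_intro_l; apply: (@lt_intro _ _ _ _ (Var ord0)).
apply: ceq_trans (weaken _ (cshift_proves hz)); ssimpl.
by apply: eq_Add (ceq_refl _ _) _; apply: ceq_sym; apply: TP_andr.
Qed.

Lemma zero_lt_succ n (G : cform n) a : G |-- CLt Zero (Succ a).
Proof. by apply: (@lt_intro _ _ _ _ a); apply: add_0l. Qed.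

Lemma succ_le n (G : cform n) a b :
  G |-- CLt a b -> G |-- COr (CEq (Succ a) b) (CLt (Succ a) b).
Proof.
move/lt_elim; apply; ssimpl; set H := CAnd _ _.
have hz : H |-- CEq (Succ (Add (tsubst (@shift n) a) (Var ord0))) (tsubst (@shift n) b).
  by apply: ceq_trans (TP_andr _ _); apply: ceq_sym; apply: addS.
apply: (@nat_case _ H (Var ord0)).
  apply: or_intro_l; apply: ceq_trans (weaken _ hz); apply: eq_Succ.
  apply: ceq_trans (ceq_sym (add0 _ _)) _; apply: eq_Add (ceq_refl _ _) _.
  by apply: ceq_sym; apply: TP_andr.
apply: or_intro_r; apply: (@lt_intro _ _ _ _ (Var ord0)).
apply: ceq_trans (weaken _ (cshift_proves hz)); ssimpl.
apply: ceq_trans (add_Sl _ _ _) _; apply: eq_Succ.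
by apply: eq_Add (ceq_refl _ _) _; apply: ceq_sym; apply: TP_andr.
Qed.

(** This makes atoms decidable: the complement of each of s = t and s < t is the disjunction of the
    other two cases. In the induction on b, the case b < a is advanced by [succ_le]. *)
Lemma trichotomy n (G : cform n) a b :
  G |-- COr (CEq a b) (COr (CLt a b) (CLt b a)).
Proof.
pose w := tsubst (@shift n).
have := @ind_elim _ G (COr (CEq (w a) (Var ord0))
   (COr (CLt (w a) (Var ord0)) (CLt (Var ord0) (w a)))) b.
rewrite /w; ssimpl; apply.
  apply: (@nat_case _ _ a); first by apply: or_intro_l; apply: TP_andr.
  ssimpl; do 2!apply: or_intro_r.
  by apply: eq_lt_r (ceq_sym (TP_andr _ _)) _; apply: zero_lt_succ.
apply: or_elim (TP_andr _ _) _ _.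
  apply: or_intro_r; apply: or_intro_l.
  by apply: eq_lt_l (ceq_sym (TP_andr _ _)) _; apply: lt_succ.
apply: or_elim (TP_andr _ _) _ _.
  apply: or_intro_r; apply: or_intro_l.
  by apply: lt_trans (TP_andr _ _) _; apply: lt_succ.
apply: or_elim (succ_le (TP_andr _ _)) _ _.
  by apply: or_intro_l; apply: ceq_sym; apply: TP_andr.
by do 2!apply: or_intro_r; apply: TP_andr.
Qed.

(* The dual Frobenius law is not part of the deduction system: it is proved by
   induction on y in [t < y \/ (forall z < y, A) \/ D]. *)
Lemma ball_or n t (A : cform n.+1) D :
  CBAll t (COr A (cshift D)) |-- COr (CBAll t A) D.
Proof.
set G := CBAll _ _; pose w := tsubst (@shift n).
pose A' := csubst (up (@shift n)) A.
(* The induction formula at y = t; its first disjunct is then refuted by irreflexivity. *)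
have: G |-- COr (CLt t t) (COr (CBAll t A) D).
  have := @ind_elim _ G (COr (CLt (w t) (Var ord0))
    (COr (CBAll (Var ord0) A') (cshift D))) t.
  rewrite /w /A'; ssimpl; apply.
    apply: or_intro_r; apply: or_intro_l; apply: TP_ball_down; apply: bot_elim.
    exact: lt0_false (TP_andr _ _).
  set H := CAnd _ _.
  have hG : H |-- cshift G by apply: TP_andl.
  apply: (or_elim (TP_andr _ _ : H |-- _)).
    by apply: or_intro_l; apply: lt_trans (TP_andr _ _) (lt_succ _ _).
  apply: or_elim (TP_andr _ _) _ _; last first.
    by do 2!apply: or_intro_r; apply: TP_andr.
  have {}hG B C : CAnd (CAnd H B) C |-- cshift G by do 2!apply: weaken.
  (* Compare y with t: if y = t or t < y, then t < s y; if y < t, the bounded hypothesis at y gives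
     A(y) or D. *)
  set K := CAnd _ _; apply: or_elim (trichotomy K (Var ord0) (tsubst (@shift n) t)) _ _.
    apply: or_intro_l; apply: eq_lt_l (TP_andr _ _) _; exact: lt_succ.
  apply: or_elim (TP_andr _ _) _ _; last first.
    by apply: or_intro_l; apply: lt_trans (TP_andr _ _) (lt_succ _ _).
  apply: or_intro_r.
  set L := CAnd _ _.
  have hL : L |-- COr A (cshift D).
    have : L |-- cshift G by do 2!apply: weaken; apply: hG.
    move/(@ball_elim _ _ _ _ (Var ord0)); ssimpl; apply; exact: TP_andr.
  apply: or_elim hL _ _; last by apply: or_intro_r; apply: TP_andr.
  apply: or_intro_l; apply: TP_ball_down.
  (* For z < s y, either z < y and the induction hypothesis applies, or z = y and A(y) is
     transported along the equality. *)
  apply: or_elim (lt_succ_inv (TP_andr _ _)) _ _.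
    have : CAnd L A |-- CBAll (Var ord0) A'.
      do 3!apply: weaken; exact: TP_andr.
    move/cshift_proves.
    move/(weaken (CLt (Var ord0) (tsubst (@shift n.+1) (Succ (Var ord0))))).
    move/(weaken (CLt (Var ord0) (tsubst (@shift n.+1) (Var ord0)))).
    move/(@ball_elim _ _ _ _ (Var ord0)); rewrite /A'; ssimpl; apply.
    exact: TP_andr.
  set M := CAnd _ (CEq _ _).
  have := eq_rew (A := csubst (scons (Var ord0)
      (comp (@shift n) (comp (@shift n.+1) (@shift n.+2)))) A)
    (ceq_sym (TP_andr _ _ : M |-- _)); rewrite {}/M; ssimpl; apply.
  by do 2!apply: weaken; ssimpl; rewrite scons_eta; apply: TP_andr.
by move/or_elim; apply; [apply: bot_elim; apply: lt_irrefl (TP_andr _ _)|apply: TP_andr].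
Qed.

(** * Forcing *)

Definition ext n m (s : 'I_n -> tm m) (G D : cform n) (G' D' : cform m) : Prop :=
  G' |-- csubst s G /\ csubst s D |-- D'.

Lemma ext_id n (G D G' D' : cform n) :
  G' |-- G -> D |-- D' -> ext (@Var n) G D G' D'.
Proof. by rewrite /ext !csubst_var. Qed.

Lemma ext_trans n m l (s : 'I_n -> tm m) (r : 'I_m -> tm l) G D G1 D1 G2 D2 :
  ext s G D G1 D1 -> ext r G1 D1 G2 D2 -> ext (comp s r) G D G2 D2.
Proof.
move=> [h1 h2] [h3 h4]; rewrite /ext -!csubst_comp; split.
  by apply: TP_cut h3 _; apply: TP_subst.
by apply: TP_cut h4; apply: TP_subst.
Qed.

Lemma ext_shift n (G D : cform n) (A : cform n.+1) :
  ext (@shift n) G D (CAnd (cshift G) A) (cshift D).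
Proof. by split; [apply: TP_andl|apply: TP_id]. Qed.

(* A condition is a pair (G, D) of coherent formulas, read "G holds and D
   fails"; the last argument assigns terms to the k free variables. *)
Definition sem k := forall m, cform m -> cform m -> ('I_k -> tm m) -> Prop.

(** As in exploding Kripke models, falsity is forced at the inconsistent conditions instead of
    nowhere. *)
Definition sBot k : sem k := fun m G D _ => G |-- D.
Definition sAtom k (A : cform k) : sem k :=
  fun m G D r => G |-- COr (csubst r A) D.
Definition sAnd k (S S' : sem k) : sem k :=
  fun m G D r => S m G D r /\ S' m G D r.
Definition sImp k (S S' : sem k) : sem k := fun m G D r =>
  forall l (s : 'I_m -> tm l) G' D', ext s G D G' D' ->
  S l G' D' (comp r s) -> S' l G' D' (comp r s).
Definition sAll k (S : sem k.+1) : sem k := fun m G D r =>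
  forall l (s : 'I_m -> tm l) G' D', ext s G D G' D' ->
  forall t, S l G' D' (scons t (comp r s)).
Definition sNot k (S : sem k) : sem k := sImp S (@sBot k).
Definition sOr k (S S' : sem k) : sem k := sNot (sAnd (sNot S) (sNot S')).
Definition sEx k (S : sem k.+1) : sem k := sNot (sAll (sNot S)).

Fixpoint forces k (A : fform k) : sem k :=
  match A with
  | FEq s t => sAtom (CEq s t)
  | FLt s t => sAtom (CLt s t)
  | FTop => sAtom CTop
  | FBot => @sBot k
  | FAnd A B => sAnd (forces A) (forces B)
  | FOr A B => sOr (forces A) (forces B)
  | FImp A B => sImp (forces A) (forces B)
  | FEx A => sEx (forces A)
  | FAll A => sAll (forces A)
  end.

(** With equality in place of equivalence, forcing clauses can be rewritten under the semantic
    connectives. *)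
Lemma sem_ext k (S S' : sem k) :
  (forall m G D r, S m G D r <-> S' m G D r) -> S = S'.
Proof.
move=> h; do 4!apply: functional_extensionality_dep => ?.
exact: propositional_extensionality.
Qed.

(** * Monotonicity and stability under double negation *)

Definition mono k (S : sem k) : Prop :=
  forall m l (s : 'I_m -> tm l) G D G' D' r,
  ext s G D G' D' -> S m G D r -> S l G' D' (comp r s).

Definition stable k (S : sem k) : Prop :=
  forall m G D r, sNot (sNot S) G D r -> S m G D r.

Lemma mono_atom k (A : cform k) : mono (sAtom A).
Proof.
move=> m l s G D G' D' r [h1 h2] h; rewrite /sAtom -csubst_comp.
apply: TP_cut h1 _; apply: TP_cut (TP_subst s h) _; exact: or_mono_r.
Qed.

Lemma mono_bot k : mono (@sBot k).
Proof.
by move=> m l s G D G' D' r [h1 h2] /(TP_subst s) h; apply: TP_cut h1 (TP_cut h h2).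
Qed.

Lemma mono_and k (S S' : sem k) : mono S -> mono S' -> mono (sAnd S S').
Proof.
by move=> h h' m l s G D G' D' r e [h1 h2]; split; [apply: h h1|apply: h' h2].
Qed.

Lemma mono_imp k (S S' : sem k) : mono (sImp S S').
Proof.
move=> m l s G D G' D' r e h l2 s2 G2 D2 e2; rewrite comp_assoc.
exact: h (ext_trans e e2).
Qed.

Lemma mono_all k (S : sem k.+1) : mono (sAll S).
Proof.
move=> m l s G D G' D' r e h l2 s2 G2 D2 e2; rewrite comp_assoc.
exact: h (ext_trans e e2).
Qed.

Lemma mono_forces k (A : fform k) : mono (forces A).
Proof.
elim: A => /= *; try exact: mono_imp; try exact: mono_all; try exact: mono_atom.
  exact: mono_bot.
exact: mono_and.
Qed.

Lemma ext_refl n (G D : cform n) : ext (@Var n) G D G D.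
Proof. by apply: ext_id; apply: TP_id. Qed.

Lemma sImp_apply k (S S' : sem k) m G D r :
  sImp S S' G D r -> S m G D r -> S' m G D r.
Proof. by move/(_ m (@Var m) G D (ext_refl G D)); rewrite comp_var_r. Qed.

Lemma sAll_apply k (S : sem k.+1) m G D r t :
  sAll S G D r -> S m G D (scons t r).
Proof. by move/(_ m (@Var m) G D (ext_refl G D) t); rewrite comp_var_r. Qed.

(* The condition (G, A \/ D) forces the negation of A, hence forces falsity. *)
Lemma stable_atom k (A : cform k) : stable (sAtom A).
Proof.
move=> m G D r h; rewrite /sAtom.
have e : ext (@Var m) G D G (COr (csubst r A) D).
  by apply: ext_id; [apply: TP_id|apply: TP_orr].
apply: (h _ _ _ _ e) => l s G' D' [h1 h2]; rewrite /sAtom /sBot comp_var_r => h3.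
apply: TP_cut h3 (TP_or _ (TP_id _)).
by apply: TP_cut h2; rewrite -csubst_comp /=; apply: TP_orl.
Qed.

Lemma stable_bot k : stable (@sBot k).
Proof. by move=> m G D r h; apply: (sImp_apply h) => l s G' D' e. Qed.

Lemma stable_and k (S S' : sem k) : stable S -> stable S' -> stable (sAnd S S').
Proof.
move=> h h' m G D r H; split; [apply: h|apply: h'] => l s G' D' e nS;
by apply: (H _ _ _ _ e) => l2 s2 G2 D2 e2 [h1 h2]; apply: nS e2 _.
Qed.

(** If S is forced and S' is refuted, the implication is refuted as well, against its double
    negation; monotonicity carries S along the extensions. *)
Lemma stable_imp k (S S' : sem k) : mono S -> stable S' -> stable (sImp S S').
Proof.
move=> mS h' m G D r H l s G' D' e hS; apply: h' => l2 s2 G2 D2 e2 nS'.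
rewrite comp_assoc in nS' *.
apply: (H _ _ _ _ (ext_trans e e2)) => l3 s3 G3 D3 e3 hi.
apply: (nS' _ _ _ _ e3); apply: (sImp_apply hi).
by apply: (mS _ _ _ _ _ _ _ _ e3); rewrite -comp_assoc; apply: (mS _ _ _ _ _ _ _ _ e2).
Qed.

Lemma stable_all k (S : sem k.+1) : stable S -> stable (sAll S).
Proof.
move=> hS m G D r H l s G' D' e t; apply: hS => l2 s2 G2 D2 e2.
rewrite comp_scons comp_assoc => nS.
apply: (H _ _ _ _ (ext_trans e e2)) => l3 s3 G3 D3 e3.
by move/(sAll_apply (tsubst s3 (tsubst s2 t))); rewrite -comp_scons; apply: nS e3.
Qed.

(** Disjunction and existence are interpreted as negations, which are stable because falsity is; the
    other connectives inherit stability from their parts. *)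
Lemma stable_forces k (A : fform k) : stable (forces A).
Proof.
elim: A => /= *; try exact: stable_atom; try exact: stable_bot.
- exact: stable_and.
- by apply: stable_imp (@stable_bot _); apply: mono_and; apply: mono_imp.
- by apply: stable_imp => //; apply: mono_forces.
- by apply: stable_imp (@stable_bot _); apply: mono_all.
- exact: stable_all.
Qed.

(** * Forcing under substitution and equality *)

Definition pull k l (s : 'I_k -> tm l) (S : sem k) : sem l :=
  fun m G D r => S m G D (comp s r).

Lemma pull_and k l (s : 'I_k -> tm l) S S' :
  pull s (sAnd S S') = sAnd (pull s S) (pull s S').
Proof. by []. Qed.

Lemma pull_imp k l (s : 'I_k -> tm l) S S' :
  pull s (sImp S S') = sImp (pull s S) (pull s S').
Proof.
apply: sem_ext => m G D r; rewrite /pull /sImp.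
by split=> h l2 s2 G2 D2 e; move: (h _ _ _ _ e); rewrite comp_assoc.
Qed.

Lemma pull_all k l (s : 'I_k -> tm l) S :
  pull s (sAll S) = sAll (pull (up s) S).
Proof.
apply: sem_ext => m G D r; rewrite /pull /sAll.
by split=> h l2 s2 G2 D2 e t; move: (h _ _ _ _ e t);
  rewrite upE !(comp_scons, comp_assoc) tsubst_Var scons0 comp_shift.
Qed.

Lemma pull_atom k l (s : 'I_k -> tm l) A : pull s (sAtom A) = sAtom (csubst s A).
Proof. by apply: sem_ext => m G D r; rewrite /pull /sAtom csubst_comp. Qed.

Lemma forces_subst k l (s : 'I_k -> tm l) A : forces (fsubst s A) = pull s (forces A).
Proof.
elim: A l s => {k} /=; try by move=> *; rewrite pull_atom.
- by [].
- by move=> k A IA B IB l s; rewrite IA IB.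
- by move=> k A IA B IB l s; rewrite /sOr /sNot !(pull_and, pull_imp) IA IB.
- by move=> k A IA B IB l s; rewrite pull_imp IA IB.
- by move=> k A IA l s; rewrite /sEx /sNot !(pull_imp, pull_all) IA.
- by move=> k A IA l s; rewrite pull_all IA.
Qed.

(** Soundness of replacing equals. The variable [ord0] in the values of r marks the places where u
    is replaced by v, and the equation is only known up to the side disjunct D. *)
Lemma forces_eq k (A : fform k) m (G D : cform m) u v (r : 'I_k -> tm m.+1) :
  G |-- COr (CEq u v) D ->
  forces A G D (comp r (inst u)) -> forces A G D (comp r (inst v)).
Proof.
(* The property is stated for arbitrary semantic values, so that the negations hidden in [sOr] and
   [sEx] are covered by the case of implication. *)
pose inv k (S : sem k) := forall m (G D : cform m) u v (r : 'I_k -> tm m.+1),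
  G |-- COr (CEq u v) D -> S _ G D (comp r (inst u)) -> S _ G D (comp r (inst v)).
have sym l (G' D' : cform l) a b : G' |-- COr (CEq a b) D' -> G' |-- COr (CEq b a) D'.
  by move/or_bind; apply; apply: or_intro_l; apply: ceq_sym (TP_andr _ _).
have emono l l' (s : 'I_l -> tm l') G1 D1 G2 D2 a b : ext s G1 D1 G2 D2 ->
    G1 |-- COr (CEq a b) D1 -> G2 |-- COr (CEq (tsubst s a) (tsubst s b)) D2.
  move=> [h1 h2] /(TP_subst s) h; apply: TP_cut h1 (TP_cut h _); exact: or_mono_r.
have inst_up l l' (s : 'I_l -> tm l') a :
    comp (inst a) s = comp (up s) (inst (tsubst s a)).
  by rewrite upE /inst !substE.
have iAtom l (B : cform l) : inv l (sAtom B).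
  move=> {}m {}G {}D {}u {}v {}r e; rewrite /sAtom -!csubst_comp => h.
  apply: or_bind e _; apply: or_bind (weaken _ h) _; apply: or_intro_l.
  by apply: eq_rew (TP_andr _ _); apply: weaken; apply: TP_andr.
have iBot l : inv l (@sBot l) by [].
have iAnd l S S' : inv l S -> inv l S' -> inv l (sAnd S S').
  by move=> h h' {}m {}G {}D {}u {}v {}r e [h1 h2]; split; [apply: h e h1|apply: h' e h2].
have iImp l S S' : inv l S -> inv l S' -> inv l (sImp S S').
  move=> h h' {}m {}G {}D {}u {}v {}r e H l2 s2 G2 D2 e2.
  move: (H _ _ _ _ e2); rewrite !comp_assoc !inst_up -!comp_assoc => {}H hS.
  apply: (h' _ _ _ (tsubst s2 u)); first exact: emono e2 e.
  (* The antecedent travels back from v to u by symmetry. *)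
  by apply: H; apply: h hS; apply: sym; apply: emono e2 e.
have iAll l S : inv l.+1 S -> inv l (sAll S).
  move=> h {}m {}G {}D {}u {}v {}r e H l2 s2 G2 D2 e2 t.
  move: (H _ _ _ _ e2 t); rewrite !comp_assoc !inst_up -!comp_assoc => {}H.
  (* The new value t is shifted past the marked variable, so replacement leaves it unchanged. *)
  have E a : scons t (comp (comp r (up s2)) (inst a)) =
      comp (scons (tsubst (@shift l2) t) (comp r (up s2))) (inst a).
    by rewrite comp_scons /inst tsubst_comp comp_shift tsubst_var.
  rewrite E; apply: h (emono _ _ _ _ _ _ _ _ _ e2 e) _.
  by rewrite -E.
suff: inv k (forces A) by move=> h; apply: h.
elim: A => {k r} /= *; try exact: iAtom; try exact: iBot.
- exact: iAnd.
- by apply: (iImp _ _ _ _ (iBot _)); apply: iAnd; apply: (iImp _ _ _ _ (iBot _)).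
- exact: iImp.
- by apply: (iImp _ _ _ _ (iBot _)); apply: iAll; apply: (iImp _ _ _ _ (iBot _)).
- exact: iAll.
Qed.

(** * Soundness of classical deduction *)

Definition valid k (A : fform k) : Prop := forall m (G D : cform m) r, forces A G D r.

(** Stability in the form used for reductio and for eliminating disjunctions and existentials. *)
Lemma forces_raa k (A : fform k) m (G D : cform m) r :
  (forall l (s : 'I_m -> tm l) G' D', ext s G D G' D' ->
    forces (FNot A) G' D' (comp r s) -> G' |-- D') -> forces A G D r.
Proof. by move=> h; apply: stable_forces. Qed.

Lemma soundness (Ax : fform 0 -> Prop) k (Gamma : seq (fform k)) A :
  (forall B, Ax B -> valid B) -> fol_proves Ax Gamma A ->
  forall m (G D : cform m) r,
  (forall B, List.In B Gamma -> forces B G D r) -> forces A G D r.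
Proof.
move=> hAx; elim=> {k Gamma A}.
- by move=> k Gamma A hA m G D r _; rewrite forces_subst; apply: hAx.
- by move=> k Gamma1 Gamma2 A m G D r; apply; apply: List.in_elt.
- by move=> *; apply: or_intro_l; apply: TP_top.
- move=> k Gamma A _ IH m G D r h; apply: forces_raa => l s G' D' e hn.
  apply: (IH _ G' D' (comp r s)) => B /= [<- //|hB].
  by apply: mono_forces e _; apply: h.
- by move=> k Gamma A B _ IA _ IB m G D r h; split; [apply: IA|apply: IB].
- by move=> k Gamma A B _ IH m G D r h; case: (IH _ _ _ _ h).
- by move=> k Gamma A B _ IH m G D r h; case: (IH _ _ _ _ h).
- move=> k Gamma A B _ IH m G D r h l s G' D' e [nA _]; apply: (sImp_apply nA).
  by apply: mono_forces e _; apply: IH.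
- move=> k Gamma A B _ IH m G D r h l s G' D' e [_ nB]; apply: (sImp_apply nB).
  by apply: mono_forces e _; apply: IH.
- move=> k Gamma A B C _ IO _ IA _ IB m G D r h.
  (* A forced disjunction is a negation and eliminates only into falsity, so the goal C is first
     negated. The existential case proceeds in the same way. *)
  apply: forces_raa => l s G' D' e nC.
  apply: (IO _ _ _ _ h _ _ _ _ e); split=> l2 s2 G2 D2 e2 h2;
    apply: (nC _ _ _ _ e2).
    apply: IA => E /= [<- //|hE].
    by apply: mono_forces e2 _; apply: mono_forces e _; apply: h.
  apply: IB => E /= [<- //|hE].
  by apply: mono_forces e2 _; apply: mono_forces e _; apply: h.
- move=> k Gamma A B _ IH m G D r h l s G' D' e hA; apply: IH => C /= [<- //|hC].
  by apply: mono_forces e _; apply: h.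
- move=> k Gamma A B _ IAB _ IA m G D r h.
  by apply: (sImp_apply (IAB _ _ _ _ h)); apply: IA.
- move=> k Gamma A _ IH m G D r h l s G' D' e t; apply: IH => B.
  case/List.in_map_iff => C [<- hC]; rewrite /fshift forces_subst /pull comp_shift.
  by apply: mono_forces e _; apply: h.
- move=> k Gamma A t _ IH m G D r h; rewrite forces_subst /pull comp_scons comp_var_l.
  by apply: (sAll_apply (S := forces A)); apply: IH.
- move=> k Gamma A t _ IH m G D r h l s G' D' e nA.
  apply: (sImp_apply (sAll_apply (tsubst s (tsubst r t)) nA)).
  rewrite -comp_scons; apply: mono_forces e _.
  by move: (IH _ _ _ _ h); rewrite forces_subst /pull comp_scons comp_var_l.
- move=> k Gamma A B _ IE _ IB m G D r h; apply: forces_raa => l s G' D' e nB.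
  apply: (IE _ _ _ _ h _ _ _ _ e) => l2 s2 G2 D2 e2 t l3 s3 G3 D3 e3 hA.
  apply: (nB _ _ _ _ (ext_trans e2 e3)).
  have := IB _ G3 D3 (scons (tsubst s3 t) (comp (comp r s) (comp s2 s3))).
  rewrite /fshift forces_subst /pull comp_shift; apply=> C /= [<-|].
    by move: hA; rewrite comp_scons !comp_assoc.
  case/List.in_map_iff => E [<- hE]; rewrite forces_subst /pull comp_shift.
  by apply: mono_forces (ext_trans e2 e3) _; apply: mono_forces e _; apply: h.
- by move=> *; apply: or_intro_l; apply: ceq_refl.
- move=> k Gamma s t A _ IE _ IA m G D r h; rewrite forces_subst /pull.
  (* Both environments are instances of a single one with a marked variable, the form required by
     [forces_eq]. *)
  have E u : comp (inst u) r =
      comp (scons (Var ord0) (comp r (@shift m))) (inst (tsubst r u)).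
    by rewrite /inst !substE.
  rewrite E; apply: forces_eq (IE _ _ _ _ h) _.
  by rewrite -E; move: (IA _ _ _ _ h); rewrite forces_subst.
Qed.

(** * Coherent, Delta0 and Sigma1 formulas forced as atoms *)

Lemma forces_ball_atom k t (A : cform k.+1) :
  sAll (sImp (sAtom (CLt (Var ord0) (tsubst (@shift k) t))) (sAtom A)) =
  sAtom (CBAll t A).
Proof.
apply: sem_ext => m G D r; split=> [h|].
  (* Extend the condition by a fresh z with z < t, which gives A or D for every z < t; [ball_or]
     then pulls D out of the bounded quantifier. *)
  have {h} := sImp_apply (h _ _ _ _
    (ext_shift G D (CLt (Var ord0) (tsubst (@shift m) (tsubst r t)))) (Var ord0)).
  rewrite /sAtom; ssimpl => h.
  apply: TP_cut (ball_or _ _ _); apply: TP_ball_down; rewrite tsubst_comp.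
  by apply: h; apply: or_intro_l; apply: TP_andr.
move=> h l s G' D' e t' l2 s2 G2 D2 e2; move: (mono_atom (ext_trans e e2) h).
rewrite /sAtom; ssimpl => h1 h2; apply: or_bind h1 _; apply: or_bind (weaken _ h2) _.
apply: or_intro_l; set K := CAnd _ _.
have := ball_elim (weaken _ (TP_andr _ _) : K |-- _) (TP_andr _ _ : K |-- _).
by rewrite {}/K; ssimpl.
Qed.

(** A negation is tested at the extension (G /\ A, D), which forces A. *)
Lemma sNot_atom k (A : cform k) m (G D : cform m) r :
  sNot (sAtom A) G D r -> CAnd G (csubst r A) |-- D.
Proof.
move=> h.
have e : ext (@Var m) G D (CAnd G (csubst r A)) D.
  by apply: ext_id; [apply: TP_andl|apply: TP_id].
by apply: (h _ _ _ _ e); rewrite comp_var_r; apply: or_intro_l; apply: TP_andr.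
Qed.

Lemma sOr_atom k (A B : cform k) : sOr (sAtom A) (sAtom B) = sAtom (COr A B).
Proof.
apply: sem_ext => m G D r; split=> h.
  apply: stable_atom => l s G' D' e n; apply: (h _ _ _ _ e).
  split=> l2 s2 G2 D2 e2 h2; apply: (n _ _ _ _ e2); apply: TP_cut h2 _;
  apply: or_mono_l => /=; first [exact: TP_orl|exact: TP_orr].
move=> l s G' D' e [nA nB]; apply: or_elim (mono_atom e h) _ (TP_andr _ _).
apply: TP_cut (TP_distr _ _ _) _.
by apply: TP_or; apply: sNot_atom.
Qed.

Lemma sEx_atom k (A : cform k.+1) : sEx (sAtom A) = sAtom (CEx A).
Proof.
apply: sem_ext => m G D r; split=> h.
  apply: stable_atom => l s G' D' e n; apply: (h _ _ _ _ e).
  move=> l2 s2 G2 D2 e2 t l3 s3 G3 D3 e3 h3.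
  apply: (n _ _ _ _ (ext_trans e2 e3)); apply: TP_cut h3 _; apply: or_mono_l => /=.
  by apply: (cex_intro (t := tsubst s3 t)); ssimpl; apply: TP_id.
move=> l s G' D' e n; apply: or_elim (mono_atom e h) _ (TP_andr _ _) => /=.
apply: ex_elim (TP_andr _ _) _.
(* The refutation of all instances is used at a fresh variable, with [CTop] as the added
   assumption. *)
have := sNot_atom (n _ _ _ _ (ext_shift G' D' CTop) (Var ord0)).
rewrite upE => h1; apply: TP_cut h1; apply: TP_and (TP_andr _ _).
by apply: TP_and (TP_top _); do 2!apply: weaken; apply: TP_id.
Qed.

Lemma sAnd_atom k (A B : cform k) : sAnd (sAtom A) (sAtom B) = sAtom (CAnd A B).
Proof.
apply: sem_ext => m G D r; split=> [[hA hB]|h].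
  apply: or_bind hA _; apply: or_bind (weaken _ hB) _; apply: or_intro_l.
  by apply: TP_and (TP_andr _ _); apply: weaken; apply: TP_andr.
split; apply: TP_cut h _; apply: or_mono_l; first exact: TP_andl.
exact: TP_andr.
Qed.

Lemma sBot_atom k : @sBot k = sAtom CBot.
Proof.
apply: sem_ext => m G D r; split=> h; first exact: or_intro_r.
by apply: TP_cut h (or_bot_l _).
Qed.

Lemma forces_embed k (A : cform k) : forces (embed A) = sAtom A.
Proof.
elim: A => {k} //=.
- exact: sBot_atom.
- by move=> k A -> B ->; rewrite sAnd_atom.
- by move=> k A -> B ->; rewrite sOr_atom.
- by move=> k A ->; rewrite sEx_atom.
- by move=> k t A ->; rewrite forces_ball_atom.
Qed.

(** The coherent complement C of B is carried along because an implication becomes [COr C B'].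
    Complements follow De Morgan's laws, starting from trichotomy for atoms. *)
Lemma delta0_coherent k (A : fform k) : delta0 A -> exists B C : cform k,
  [/\ forces A = sAtom B, CTop |-- COr B C & CAnd B C |-- CBot].
Proof.
elim=> {k A}.
- move=> k s t; exists (CEq s t), (COr (CLt s t) (CLt t s)); split=> //.
    exact: trichotomy.
  apply: or_elim (TP_andr _ _) _ _; apply: lt_irrefl.
    by apply: eq_lt_l (TP_andr _ _); apply: weaken; apply: TP_andl.
  by apply: eq_lt_r (TP_andr _ _); apply: weaken; apply: TP_andl.
- move=> k s t; exists (CLt s t), (COr (CEq s t) (CLt t s)); split=> //.
    apply: or_elim (trichotomy _ s t) _ _.
      by apply: or_intro_r; apply: or_intro_l; apply: TP_andr.
    apply: TP_cut (TP_andr _ _) _; apply: or_mono_r; exact: TP_orr.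
  apply: or_elim (TP_andr _ _) _ _.
    apply: lt_irrefl; apply: eq_lt_l (TP_andr _ _) _; apply: weaken; exact: TP_andl.
  by apply: lt_asym (TP_andr _ _); apply: weaken; apply: TP_andl.
- by move=> k; exists CTop, CBot; split=> //; [apply: TP_orl|apply: TP_andr].
- move=> k; exists CBot, CTop; split; [exact: sBot_atom|exact: TP_orr|exact: TP_andl].
- move=> k A A' _ [B [C [e h1 h2]]] _ [B' [C' [e' h1' h2']]].
  exists (CAnd B B'), (COr C C'); split=> /=; first by rewrite e e' sAnd_atom.
    apply: or_elim h1 _ _; last first.
      by apply: or_intro_r; apply: or_intro_l; apply: TP_andr.
    apply: or_elim (TP_cut (TP_top _) h1') _ _; last first.
      by do 2!apply: or_intro_r; apply: TP_andr.
    by apply: or_intro_l; apply: TP_and (TP_andr _ _); apply: weaken; apply: TP_andr.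
  apply: or_elim (TP_andr _ _) _ _; [apply: TP_cut h2|apply: TP_cut h2'];
    apply: TP_and (TP_andr _ _); do 2!apply: weaken;
    [exact: TP_andl|exact: TP_andr].
- move=> k A A' _ [B [C [e h1 h2]]] _ [B' [C' [e' h1' h2']]].
  exists (COr B B'), (CAnd C C'); split=> /=; first by rewrite e e' sOr_atom.
    apply: or_elim h1 _ _.
      by do 2!apply: or_intro_l; apply: TP_andr.
    apply: or_elim (TP_cut (TP_top _) h1') _ _.
      by apply: or_intro_l; apply: or_intro_r; apply: TP_andr.
    by apply: or_intro_r; apply: TP_and (TP_andr _ _); apply: weaken; apply: TP_andr.
  apply: or_elim (TP_andl _ _) _ _; [apply: TP_cut h2|apply: TP_cut h2'];
    apply: TP_and (TP_andr _ _) _; apply: weaken; apply: TP_cut (TP_andr _ _) _;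
    [exact: TP_andl|exact: TP_andr].
- move=> k A A' _ [B [C [e h1 h2]]] _ [B' [C' [e' h1' h2']]].
  exists (COr C B'), (CAnd B C'); split=> /=.
  + rewrite e e'; apply: sem_ext => m G D r; split=> [h|h l s G' D' e1 hB].
      (* Decide B: if C holds, the disjunction follows at once; if B holds, adding B to G gives a
         condition where the implication can be applied. *)
      apply: or_elim (TP_cut (TP_top _) (TP_subst r h1)) _ _ => /=; last first.
        by do 2!apply: or_intro_l; apply: TP_andr.
      have ex : ext (@Var m) G D (CAnd G (csubst r B)) D.
        by apply: ext_id; [apply: TP_andl|apply: TP_id].
      have := h _ _ _ _ ex; rewrite comp_var_r /sAtom.
      move/(_ (or_intro_l _ (TP_andr _ _)))/TP_cut; apply; apply: or_mono_l; apply: TP_orr.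
    apply: or_bind (mono_atom e1 h) _; apply: or_bind (weaken _ hB) _ => /=.
    apply: or_elim (weaken _ (TP_andr _ _)) _ _; last first.
      by apply: or_intro_l; apply: TP_andr.
    apply: bot_elim; apply: TP_cut (TP_subst (comp r s) h2) => /=.
    by apply: TP_and (TP_andr _ _); apply: weaken; apply: TP_andr.
  + apply: or_elim h1 _ _; last by do 2!apply: or_intro_l; apply: TP_andr.
    apply: or_elim (TP_cut (TP_top _) h1') _ _.
      by apply: or_intro_l; apply: or_intro_r; apply: TP_andr.
    by apply: or_intro_r; apply: TP_and (TP_andr _ _); apply: weaken; apply: TP_andr.
  + apply: or_elim (TP_andl _ _) _ _.
      apply: TP_cut h2; apply: TP_and (TP_andr _ _).
      by apply: weaken; apply: TP_cut (TP_andr _ _) (TP_andl _ _).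
    apply: TP_cut h2'; apply: TP_and (TP_andr _ _) _.
    by apply: weaken; apply: TP_cut (TP_andr _ _) (TP_andr _ _).
- move=> k t A _ [B [C [e h1 h2]]].
  pose lt := CLt (Var ord0) (tsubst (@shift k) t).
  exists (CBAll t B), (CEx (CAnd lt C)); split=> /=.
  + by rewrite e forces_ball_atom.
  (* Here D is the bounded existential of C: each z < t satisfies B, or else C and thus D. *)
  + apply: TP_cut (ball_or _ _ _); apply: TP_ball_down.
    apply: or_elim (TP_cut (TP_top _) h1) _ _; first by apply: or_intro_l; apply: TP_andr.
    apply: or_intro_r; apply: TP_cut (TP_ex_up (TP_id _)).
    by apply: TP_and (TP_andr _ _); apply: weaken; apply: TP_andr.
  + apply: ex_elim (TP_andr _ _) _; apply: TP_cut h2; apply: TP_and; last first.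
      by apply: TP_cut (TP_andr _ _) (TP_andr _ _).
    apply: TP_cut (TP_ball_up (TP_id (CBAll t B))); apply: TP_and.
      by apply: weaken; apply: cshift_proves; apply: TP_andl.
    by apply: TP_cut (TP_andr _ _) (TP_andl _ _).
- move=> k t A _ [B [C [e h1 h2]]].
  pose lt := CLt (Var ord0) (tsubst (@shift k) t).
  exists (CEx (CAnd lt B)), (CBAll t C); split=> /=.
  + by rewrite e sAnd_atom sEx_atom.
  (* The disjuncts are swapped so that [ball_or] applies with the existential as side formula. *)
  + apply: TP_cut (TP_or (TP_orr _ _) (TP_orl _ _)).
    apply: TP_cut (ball_or _ _ _); apply: TP_ball_down.
    apply: or_elim (TP_cut (TP_top _) h1) _ _; last by apply: or_intro_l; apply: TP_andr.
    apply: or_intro_r; apply: TP_cut (TP_ex_up (TP_id _)).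
    by apply: TP_and (TP_andr _ _); apply: weaken; apply: TP_andr.
  + apply: ex_elim (TP_andl _ _) _; apply: TP_cut h2; apply: TP_and.
      by apply: TP_cut (TP_andr _ _) (TP_andr _ _).
    apply: TP_cut (TP_ball_up (TP_id (CBAll t C))); apply: TP_and.
      by apply: weaken; apply: cshift_proves; apply: TP_andr.
    by apply: TP_cut (TP_andr _ _) (TP_andl _ _).
Qed.

Lemma sigma1_coherent k (A : fform k) :
  sigma1 A -> exists B : cform k, forces A = sAtom B.
Proof.
elim=> {k A} [k A /delta0_coherent [B [_ [e _ _]]]|k A _ [B e]]; first by exists B.
by exists (CEx B); rewrite /= e sEx_atom.
Qed.

(** * Validity of the axioms and conservativity *)

Lemma valid_univ_closure k (A : fform k) : valid (univ_closure A) <-> valid A.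
Proof.
elim: k A => [//|k IH] A /=; rewrite IH; split=> h m G D r.
  by move: (sAll_apply (r ord0) (h _ G D (comp (@shift k) r))); rewrite scons_eta.
by move=> l s G' D' e t; apply: h.
Qed.

Lemma valid_imp k (A B : cform k) : A |-- B -> valid (FImp (embed A) (embed B)).
Proof.
rewrite /valid /= !forces_embed => h m G D r l s G' D' _ hA.
by apply: TP_cut hA _; apply: or_mono_l; apply: TP_subst.
Qed.

Lemma valid_atom k (A : cform k) : CTop |-- A -> valid (embed A).
Proof.
move=> h m G D r; rewrite forces_embed; apply: or_intro_l.
exact (TP_cut (TP_top _) (TP_subst r h)).
Qed.

(* IndR is applied to the formula A \/ D. *)
Lemma valid_ind k (A : fform k.+1) : sigma1 A ->
  valid (FImp (FAnd (fsubst (inst Zero) A) (FAll (FImp A (fsubst (@succ_inst k) A))))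
              (FAll A)).
Proof.
case/sigma1_coherent=> B e; rewrite /valid /= !forces_subst e !pull_atom.
move=> m0 _ _ r0 m s0 G D _; move: (comp r0 s0) => r [h0 hS] l s G' D' [hG hD] t.
(* The forced induction step is taken at a fresh y with A(y) added to the condition; this is the
   premise that IndR asks for. *)
have {}hS := sImp_apply (hS _ _ _ _ (ext_shift G D (csubst (up r) B)) (Var ord0)).
have: cshift G |-- COr (csubst (up r) B) (cshift D).
  apply: TP_indR.
    by move: h0; rewrite /sAtom; ssimpl.
  apply: or_elim (TP_andr _ _) _ _; last by ssimpl; apply: or_intro_r; apply: TP_andr.
  move: hS; rewrite /sAtom; ssimpl => hS.
  apply: TP_cut (hS (or_intro_l _ (TP_andr _ _))).
  by apply: TP_and (TP_andr _ _); do 2!apply: weaken; apply: TP_id.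
(* The derived sequent for a generic y is instantiated at t and moved to the extension along s. *)
move/(TP_subst (scons t s)); rewrite /sAtom; ssimpl => h.
apply: TP_cut hG (TP_cut h _); exact: or_mono_r.
Qed.

Lemma ISigma1_valid (A : fform 0) : ISigma1 A -> valid A.
Proof.
case=> {A} [|x y|x|x y|x|x y|k s t h|x y|k A hA]; apply/valid_univ_closure.
- exact: (@valid_imp _ _ CBot (succ_neq0 (TP_id _))).
- exact: (@valid_imp _ (CEq _ _) (CEq _ _) (succ_inj (TP_id _))).
- exact: (@valid_atom _ (CEq _ _) (add0 _ _)).
- exact: (@valid_atom _ (CEq _ _) (addS _ _ _)).
- exact: (@valid_atom _ (CEq _ _) (mul0 _ _)).
- exact: (@valid_atom _ (CEq _ _) (mulS _ _ _)).
- exact: (@valid_atom _ (CEq _ _) (TP_ax (T_def h))).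
- move=> m G D r; split.
    exact: (valid_imp (TP_ax T_lt_ex)).
  exact: (valid_imp (TP_ax T_ex_lt)).
- exact: valid_ind.
Qed.

Theorem theorem6p1 (n : nat) (phi psi : cform n) :
  ISigma1_proves phi psi -> T_proves phi psi.
Proof.
move=> h.
have /valid_univ_closure : valid (univ_closure (FImp (embed phi) (embed psi))).
  by move=> m G D r; apply: (soundness ISigma1_valid h).
rewrite /valid /= !forces_embed => /(_ n phi CBot (@Var n))/sImp_apply.
rewrite /sAtom !csubst_var => {}h.
(* The antecedent is forced at its own condition by [TP_orl]; the remaining disjunct bot is
   discarded. *)
exact: TP_cut (h (TP_orl _ _)) (TP_or (TP_id _) (TP_bot _)).
Qed.
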